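(* Let $n\ge 1$, let $A\in\mathbb{R}^{n\times n}$, let $c>0$, and let $Z\in\{0,1\}^{n\times n}$. Consider the problem \[ \text{(P)}\qquad \min_{B,D\in\mathbb{R}^{n\times n}} \|A-B\|_F \quad\text{subject to}\quad \|D\|_2\le c,\quad Z_{ij}D_{ij}=0\ \text{for all } i,j,\quad D=|B|. \] Define $R=|A|$. For $\Lambda\in\mathbb{R}^{n\times n}$ and $M\in\mathbb{R}^{n\times n}$ with $M\ge 0$ (entrywise), let $D(\Lambda,M)=\Pi_c[R+M-\Lambda\odot Z]$ and \[ g(\Lambda,M)=\tfrac12\|D(\Lambda,M)-R\|_F^2+\Lambda\cdot Z\cdot D(\Lambda,M)-M\cdot D(\Lambda,M). \] Then problem (P) is equivalent to the problem $\max_{M\ge 0,\Lambda} g(\Lambda,M)$, where $g(\Lambda,M)=\min_{D:\|D\|_2\le c}\left(\tfrac12\|D-R\|_F^2+\Lambda\cdot Z\cdot D-M\cdot D\right)$ is the Lagrangian dual function (with multipliers $\Lambda$ for the constraints $Z_{ij}D_{ij}=0$ and $M\ge0$ for the constraints $D\ge 0$), and the gradients of $g$ are \[ \frac{dg}{d\Lambda}=Z\odot D(\Lambda,M),\qquad \frac{dg}{dM}=-D(\Lambda,M). \]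
   Context: $\|\cdot\|_F$ is the Frobenius norm and $\|\cdot\|_2$ the spectral norm (largest singular value). $|B|$ denotes the entrywise absolute value, $\odot$ the entrywise (Hadamard) product, and for matrices of equal size $X\cdot Y=\sum_{ij}X_{ij}Y_{ij}$ and the triple dot product $X\cdot Y\cdot W=\sum_{ij}X_{ij}Y_{ij}W_{ij}$. For a matrix $X$ with singular value decomposition $X=USV^T$, $\Pi_c[X]=US'V^T$ with $S'_{ii}=\min(S_{ii},c)$; this is the Frobenius-norm-closest matrix to $X$ among matrices with spectral norm at most $c$. The matrix $Z$ encodes a graph structure: $Z_{ij}=0$ if $(i,j)$ is an edge and $Z_{ij}=1$ otherwise. *)

(* Defs.v *)
From HB Require Import structures.
From mathcomp Require Import all_boot all_order all_algebra.
From mathcomp Require Import all_classical all_reals all_analysis.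
Set Implicit Arguments.
Unset Strict Implicit.
Unset Printing Implicit Defensive.
Import Order.TTheory GRing.Theory Num.Theory.
Import numFieldNormedType.Exports.
Local Open Scope classical_set_scope.
Local Open Scope ring_scope.

Section MatrixDefs.
Variable R : realType.

Definition frob_dot m n (X Y : 'M[R]_(m, n)) : R :=
  \sum_(i < m) \sum_(j < n) X i j * Y i j.

Definition frob_dot3 m n (X Y W : 'M[R]_(m, n)) : R :=
  \sum_(i < m) \sum_(j < n) X i j * Y i j * W i j.

Definition frob_norm m n (X : 'M[R]_(m, n)) : R := Num.sqrt (frob_dot X X).

Definition mx_abs m n (X : 'M[R]_(m, n)) : 'M[R]_(m, n) := map_mx (fun x => `|x|) X.
Definition hadamard m n (X Y : 'M[R]_(m, n)) : 'M[R]_(m, n) :=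
  \matrix_(i, j) (X i j * Y i j).

Definition vnorm n (v : 'cV[R]_n) : R := Num.sqrt (\sum_(i < n) v i 0 ^+ 2).

Definition spec_norm n (X : 'M[R]_n) : R :=
  sup [set vnorm (X *m v) | v in [set v : 'cV[R]_n | vnorm v <= 1]].

Definition is_svd n (X U : 'M[R]_n) (s : 'rV[R]_n) (V : 'M[R]_n) : Prop :=
  U^T *m U = 1%:M /\ V^T *m V = 1%:M /\ (forall i, 0 <= s 0 i) /\
  X = U *m diag_mx s *m V^T.

Definition is_clip n (c : R) (X Y : 'M[R]_n) : Prop :=
  exists U s V, is_svd X U s V /\
    Y = U *m diag_mx (map_mx (fun x => Num.min x c) s) *m V^T.

(* Pi_c[X]  (a choice of such Y; Y is independent of the chosen SVD) *)
Definition Pi_c n (c : R) (X : 'M[R]_n) : 'M[R]_n := xget 0 [set Y | is_clip c X Y].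

End MatrixDefs.

(* Main.v *)
(** Pi_c[X] is the Frobenius projection onto the spectral ball: writing
    X = U S V^T and Y = U S' V^T, the residual X - Y = U (S - S') V^T is
    supported where S' = c, and every D with |D|_2 <= c has (U^T D V)_ii <= c,
    so (X - Y).(D - Y) <= 0.  This variational inequality makes
    Pi_c[R + N] the minimizer of the Lagrangian, where N = M - L o Z, and makes
    Pi_c nonexpansive; a minimum of affine functions whose minimizer is
    Lipschitz is differentiable, with a quadratic remainder.

    Strong duality: the dual function is continuous and, because a small ball
    lies inside the spectral ball, tends to -oo as N grows, so it attains its
    maximum over the cone of admissible N at some N0.  The first-order
    conditions there say exactly that D0 = Pi_c[R + N0] is feasible and
    complementary to N0, so D0 is primal optimal with the same value.  Finally
    | |A| - |B| | <= |A - B| entrywise, with equality when B carries the signs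
    of A, which turns the problem in D back into (P). *)
Require Import Defs.
From HB Require Import structures.
From mathcomp Require Import all_boot all_order all_algebra.
From mathcomp Require Import all_classical all_reals all_analysis.
From mathcomp Require Import lra ring.
Import Order.TTheory GRing.Theory Num.Theory.
Import numFieldNormedType.Exports.
Local Open Scope classical_set_scope.
Local Open Scope ring_scope.

Set Implicit Arguments.
Unset Strict Implicit.
Unset Printing Implicit Defensive.

(** * Frobenius inner product, Cauchy-Schwarz, and the spectral norm as an operator bound *)

Section FrobDot.
Context {R : realType}.

Lemma frob_dotE m n (X Y : 'M[R]_(m, n)) : frob_dot X Y = \tr (X^T *m Y).
Proof.
rewrite /frob_dot exchange_big /=; apply: eq_bigr => j _.
by rewrite mxE; apply: eq_bigr => i _; rewrite mxE.
Qed.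

Lemma frob_dotC m n (X Y : 'M[R]_(m, n)) : frob_dot X Y = frob_dot Y X.
Proof. by apply: eq_bigr => i _; apply: eq_bigr => j _; rewrite mulrC. Qed.

Lemma frob_dotDr m n (X Y W : 'M[R]_(m, n)) :
  frob_dot X (Y + W) = frob_dot X Y + frob_dot X W.
Proof. by rewrite !frob_dotE mulmxDr raddfD. Qed.

Lemma frob_dotDl m n (X Y W : 'M[R]_(m, n)) :
  frob_dot (Y + W) X = frob_dot Y X + frob_dot W X.
Proof. by rewrite !(frob_dotC _ X) frob_dotDr. Qed.

Lemma frob_dotNr m n (X Y : 'M[R]_(m, n)) : frob_dot X (- Y) = - frob_dot X Y.
Proof. by rewrite !frob_dotE mulmxN raddfN. Qed.

Lemma frob_dotNl m n (X Y : 'M[R]_(m, n)) : frob_dot (- Y) X = - frob_dot Y X.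
Proof. by rewrite !(frob_dotC _ X) frob_dotNr. Qed.

Lemma frob_dotZr m n a (X Y : 'M[R]_(m, n)) :
  frob_dot X (a *: Y) = a * frob_dot X Y.
Proof. by rewrite !frob_dotE -scalemxAr mxtraceZ. Qed.

Lemma frob_dotZl m n a (X Y : 'M[R]_(m, n)) :
  frob_dot (a *: Y) X = a * frob_dot Y X.
Proof. by rewrite !(frob_dotC _ X) frob_dotZr. Qed.

Lemma frob_dot0r m n (X : 'M[R]_(m, n)) : frob_dot X 0 = 0.
Proof. by rewrite frob_dotE mulmx0 mxtrace0. Qed.

Definition frob_dot_lin := (@frob_dotDr, @frob_dotDl, @frob_dotNr, @frob_dotNl,
  @frob_dotZr, @frob_dotZl).

Lemma frob_dot_mull m n p (U : 'M[R]_(m, n)) (X : 'M[R]_(n, p)) Y :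
  frob_dot (U *m X) Y = frob_dot X (U^T *m Y).
Proof. by rewrite !frob_dotE trmx_mul mulmxA. Qed.

Lemma frob_dot_mulr m n p (V : 'M[R]_(p, n)) (X : 'M[R]_(m, p)) Y :
  frob_dot (X *m V) Y = frob_dot X (Y *m V^T).
Proof. by rewrite !frob_dotE trmx_mul -mulmxA mxtrace_mulC mulmxA. Qed.

Lemma frob_dot_diag n (s : 'rV[R]_n) Y :
  frob_dot (diag_mx s) Y = \sum_i s 0 i * Y i i.
Proof.
apply: eq_bigr => i _; rewrite (bigD1 i) //= big1 ?addr0; first by rewrite mxE eqxx.
by move=> j ji; rewrite mxE eq_sym (negPf ji) mul0r.
Qed.

Lemma frob_dot_delta m n i j (X : 'M[R]_(m, n)) :
  frob_dot (delta_mx i j) X = X i j.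
Proof.
rewrite /frob_dot (bigD1 i) //= (bigD1 j) //= mxE !eqxx mul1r !big1 ?addr0 //.
  by move=> k ki; apply: big1 => l _; rewrite mxE (negPf ki) mul0r.
by move=> k kj; rewrite mxE (negPf kj) andbF mul0r.
Qed.

(** Read as the bilinear form e_i . X e_j, an entry becomes accessible to operator bounds and
    orthogonal changes of basis. *)
Lemma entryE m n i j (X : 'M[R]_(m, n)) :
  X i j = frob_dot (delta_mx i 0 : 'cV[R]_m) (X *m (delta_mx j 0 : 'cV[R]_n)).
Proof. by rewrite frob_dot_delta -colE mxE. Qed.

Lemma frob_dot_ge0 m n (X : 'M[R]_(m, n)) : 0 <= frob_dot X X.
Proof. by do 2!apply: sumr_ge0 => ? _; rewrite -expr2 sqr_ge0. Qed.

Lemma entry_sqr_le m n (X : 'M[R]_(m, n)) i j : X i j ^+ 2 <= frob_dot X X.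
Proof.
rewrite /frob_dot (bigD1 i) //= (bigD1 j) //= -expr2 -addrA lerDl addr_ge0 //.
  by apply: sumr_ge0 => ? _; rewrite -expr2 sqr_ge0.
by do 2!apply: sumr_ge0 => ? _; rewrite -expr2 sqr_ge0.
Qed.

Lemma frob_dot_eq0 m n (X : 'M[R]_(m, n)) : frob_dot X X = 0 -> X = 0.
Proof.
move=> X0; apply/matrixP => i j; rewrite mxE; apply/eqP.
by rewrite -sqrf_eq0 eq_le sqr_ge0 -X0 entry_sqr_le.
Qed.

Lemma frob_normE m n (X : 'M[R]_(m, n)) : frob_norm X ^+ 2 = frob_dot X X.
Proof. by rewrite sqr_sqrtr // frob_dot_ge0. Qed.

Lemma frob_norm_ge0 m n (X : 'M[R]_(m, n)) : 0 <= frob_norm X.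
Proof. exact: sqrtr_ge0. Qed.

Lemma frob_norm_eq0 m n (X : 'M[R]_(m, n)) : frob_norm X = 0 -> X = 0.
Proof. by move=> X0; apply: frob_dot_eq0; rewrite -frob_normE X0 expr0n. Qed.

Lemma vnormE n (v : 'cV[R]_n) : vnorm v = frob_norm v.
Proof.
by congr Num.sqrt; apply: eq_bigr => i _; rewrite big_ord1 expr2.
Qed.

Lemma frob_normZ m n a (X : 'M[R]_(m, n)) : 0 <= a ->
  frob_norm (a *: X) = a * frob_norm X.
Proof.
by move=> a0; rewrite /frob_norm !frob_dot_lin mulrA -expr2 sqrtrM ?sqr_ge0 //
  sqrtr_sqr ger0_norm.
Qed.

(** The squared norm of |Y|^2 X - (X.Y) Y is nonnegative and factors as |Y|^2 (|X|^2 |Y|^2 -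
    (X.Y)^2). *)
Lemma frob_dot_CS m n (X Y : 'M[R]_(m, n)) :
  `|frob_dot X Y| <= frob_norm X * frob_norm Y.
Proof.
rewrite -(ler_pXn2r (_ : (0 < 2)%N)) ?nnegrE ?mulr_ge0 ?frob_norm_ge0 //.
rewrite exprMn !frob_normE real_normK ?num_real //.
have [Y0|Yn0] := eqVneq (frob_dot Y Y) 0.
  by rewrite (frob_dot_eq0 Y0) !frob_dot0r mulr0 expr0n.
have Ypos : 0 < frob_dot Y Y by rewrite lt_def Yn0 frob_dot_ge0.
have := frob_dot_ge0 (frob_dot Y Y *: X - frob_dot X Y *: Y).
rewrite !frob_dot_lin (frob_dotC Y X) => H.
have {}H : 0 <= frob_dot Y Y * (frob_dot X X * frob_dot Y Y - frob_dot X Y ^+ 2).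
  by apply: le_trans H _; rewrite le_eqVlt; apply/orP; left; apply/eqP; ring.
by rewrite pmulr_rge0 // subr_ge0 in H.
Qed.

Lemma entry_le_frob m n (X : 'M[R]_(m, n)) i j : `|X i j| <= frob_norm X.
Proof.
rewrite -(ler_pXn2r (_ : (0 < 2)%N)) ?nnegrE ?frob_norm_ge0 //.
by rewrite frob_normE real_normK ?num_real // entry_sqr_le.
Qed.

Lemma frob_norm_isom m n (U : 'M[R]_m) (X : 'M[R]_(m, n)) : U^T *m U = 1%:M ->
  frob_norm (U *m X) = frob_norm X.
Proof. by move=> UU; rewrite /frob_norm frob_dot_mull mulmxA UU mul1mx. Qed.

Lemma frob_norm_mul m n p (X : 'M[R]_(m, n)) (Y : 'M[R]_(n, p)) :
  frob_norm (X *m Y) <= frob_norm X * frob_norm Y.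
Proof.
rewrite -(ler_pXn2r (_ : (0 < 2)%N)) ?nnegrE ?mulr_ge0 ?frob_norm_ge0 //.
rewrite exprMn !frob_normE /frob_dot mulr_suml; apply: ler_sum => i _.
rewrite [X in _ <= _ * X]exchange_big /= mulr_sumr; apply: ler_sum => j _.
have rowE : frob_dot (row i X)^T (row i X)^T = \sum_k X i k * X i k.
  by apply: eq_bigr => k _; rewrite big_ord1 !mxE.
have colE : frob_dot (col j Y) (col j Y) = \sum_k Y k j * Y k j.
  by apply: eq_bigr => k _; rewrite big_ord1 !mxE.
have -> : (X *m Y) i j = frob_dot (row i X)^T (col j Y).
  by rewrite mxE; apply: eq_bigr => k _; rewrite big_ord1 !mxE.
rewrite -rowE -colE -!frob_normE -exprMn -expr2 -(real_normK (num_real (frob_dot _ _))).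
by rewrite ler_pXn2r ?nnegrE ?mulr_ge0 ?frob_norm_ge0 // frob_dot_CS.
Qed.

(** Trades the supremum for a homogeneous bound. Submultiplicativity of the Frobenius norm bounds
    the set, so its [sup] is a genuine upper bound. *)
Lemma spec_norm_leP n (X : 'M[R]_n) c : 0 <= c ->
  spec_norm X <= c <-> (forall v : 'cV[R]_n, frob_norm (X *m v) <= c * frob_norm v).
Proof.
move=> c0; split=> [Xc v|Xc]; last first.
  apply: ge_sup => [|_ [v /= v1 <-]].
    exists (vnorm (X *m (0 : 'cV[R]_n))); exists 0 => //=.
    by rewrite vnormE /frob_norm frob_dot0r sqrtr0 ler01.
  by rewrite !vnormE in v1 *; apply: le_trans (Xc _) _; rewrite ler_piMr.
have [v0|vn0] := eqVneq (frob_norm v) 0.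
  by rewrite (frob_norm_eq0 v0) mulmx0 /frob_norm frob_dot0r sqrtr0 mulr0.
have vpos : 0 < frob_norm v by rewrite lt_def vn0 frob_norm_ge0.
rewrite -ler_pdivrMr // mulrC -frob_normZ ?invr_ge0 ?frob_norm_ge0 //.
rewrite scalemxAr -vnormE; apply: le_trans Xc; apply: ub_le_sup.
  exists (frob_norm X) => _ [w /= w1 <-]; rewrite !vnormE in w1 *.
  by apply: le_trans (frob_norm_mul _ _) _; rewrite ler_piMr ?frob_norm_ge0.
exists ((frob_norm v)^-1 *: v) => //=.
by rewrite vnormE frob_normZ ?invr_ge0 ?frob_norm_ge0 // mulVf.
Qed.

End FrobDot.

(** * Compactness for matrices and existence of the singular value decomposition *)

Section SVD.
Context {R : realType}.

Lemma mx_norm_le m n (X : 'M[R]_(m, n)) e : 0 <= e ->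
  (forall i j, `|X i j| <= e) -> `|X| <= e.
Proof.
move=> e0 Xe; rewrite [leLHS]/Num.norm /= mx_normrE.
by apply/bigmax_leP; split => // -[i j] _ /=.
Qed.

Lemma entry_le_norm m n (X : 'M[R]_(m, n)) i j : `|X i j| <= `|X|.
Proof.
by rewrite [leRHS]/Num.norm /= mx_normrE; apply/bigmax_geP; right; exists (i, j).
Qed.

Lemma lipschitz_continuous (V W : normedModType R) (f : V -> W) C :
  (forall x y, `|f x - f y| <= C * `|x - y|) -> continuous f.
Proof.
move=> fC x; apply/cvgrPdist_lt => e e0.
have C1 : 0 < `|C| + 1 by rewrite ltr_wpDl.
near=> y; apply: le_lt_trans (fC _ _) _.
apply: le_lt_trans (_ : (`|C| + 1) * `|x - y| < _).
  by rewrite ler_wpM2r // (le_trans (ler_norm _)) // lerDl.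
rewrite -ltr_pdivlMl //; near: y; apply: cvgr_dist_lt => //.
by rewrite mulr_gt0 ?invr_gt0.
Unshelve. all: by end_near. Qed.

(** Heine-Borel for row vectors, carried over by the continuous reshaping [vec_mx]. *)
Lemma mx_bounded_closed_compact m n (A : set 'M[R]_(m, n)) b :
  (forall X, A X -> forall i j, `|X i j| <= b) -> closed A -> compact A.
Proof.
move=> Ab Acl.
have vec_cont : continuous (@vec_mx R m n).
  apply: (@lipschitz_continuous _ _ _ 1) => x y.
  by rewrite mul1r -raddfB; apply: mx_norm_le => // i j; rewrite mxE entry_le_norm.
have -> : A = @vec_mx R m n @` (@vec_mx R m n @^-1` A).
  apply/seteqP; split=> [X AX|_ [v Av <-]] //.
  by exists (mxvec X); rewrite /= mxvecK.
apply: continuous_compact; first exact: continuous_subspaceT.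
apply: bounded_closed_compact.
  exists `|b|; split=> [|x bx v /= Av]; first exact: num_real.
  apply: mx_norm_le => [|i k]; first by rewrite (le_trans _ (ltW bx)).
  rewrite ord1; case/mxvec_indexP: k => k l; rewrite -{1}(vec_mxK v) mxvecE.
  by apply: le_trans (Ab _ Av _ _) (le_trans (ler_norm _) (ltW bx)).
apply: preimage_closed => // x _; exact: vec_cont.
Qed.

Lemma frob_dot_continuous (T : topologicalType) m n (f g : T -> 'M[R]_(m, n)) :
  continuous f -> continuous g -> continuous (fun x => frob_dot (f x) (g x) : R).
Proof.
have coordc (h : T -> 'M[R]_(m, n)) i j x :
    continuous h -> {for x, continuous (fun y => h y i j)}.
  by move=> hc; apply: (@continuous_comp _ _ _ h (fun M => M i j)) (hc x) _; exact: coord_continuous.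
move=> fc gc x; rewrite /frob_dot.
apply: cvg_big => [|i _]; first exact: add_continuous.
apply: cvg_big => [|j _]; first exact: add_continuous.
by apply: cvgM; apply: coordc.
Qed.

Lemma mulmx_continuous m n p (X : 'M[R]_(m, n)) :
  continuous (mulmx X : 'M[R]_(n, p) -> 'M[R]_(m, p)).
Proof.
apply: (@lipschitz_continuous _ _ _ (\sum_i \sum_k `|X i k|)) => v w.
rewrite -mulmxBr; apply: mx_norm_le => [|i j].
  by rewrite mulr_ge0 // sumr_ge0 // => ? _; rewrite sumr_ge0.
rewrite mxE mulr_suml (bigD1 i) //= (le_trans (ler_norm_sum _ _ _)) //.
rewrite -[leLHS]addr0 lerD //.
  rewrite mulr_suml; apply: ler_sum => k _.
  by rewrite normrM ler_wpM2l // entry_le_norm.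
by apply: sumr_ge0 => k _; rewrite mulr_ge0 // sumr_ge0.
Qed.

(** [v] maximizes |Xv| on the compact unit sphere and [u] is Xv normalized; Cauchy-Schwarz then
    makes u . Xv the operator norm. *)
Lemma top_singular_pair n (X : 'M[R]_n.+1) : exists u v : 'cV[R]_n.+1,
  [/\ frob_dot u u = 1, frob_dot v v = 1, 0 <= frob_dot u (X *m v) &
   forall a b : 'cV[R]_n.+1, frob_dot a (X *m b) <=
     frob_dot u (X *m v) * (frob_norm a * frob_norm b)].
Proof.
pose S := [set v : 'cV[R]_n.+1 | frob_dot v v = 1].
have deltaS i : S (delta_mx i 0) by rewrite /S /= frob_dot_delta mxE !eqxx.
have idc : continuous (fun v : 'cV[R]_n.+1 => v) by move=> ?; exact: cvg_id.
have Scl : closed S.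
  apply: (@preimage_closed _ _ (fun v : 'cV[R]_n.+1 => frob_dot v v) [set x | x = 1]).
    by move=> v _; exact: frob_dot_continuous.
  exact: closed_eq.
have Scompact : compact S.
  apply: (@mx_bounded_closed_compact _ _ _ 1) => // v Sv i j.
  by rewrite (le_trans (entry_le_frob _ _ _)) // /frob_norm Sv sqrtr1.
have [||v vS vmax] := @compact_EVT_max _ _
    (fun v : 'cV[R]_n.+1 => frob_dot (X *m v) (X *m v)) S _ Scompact.
- by exists (delta_mx 0 0).
- by apply/continuous_subspaceT/frob_dot_continuous; exact: mulmx_continuous.
rewrite inE in vS.
set s := frob_norm (X *m v).
have sbound (b : 'cV[R]_n.+1) : frob_norm (X *m b) <= s * frob_norm b.
  have [b0|bn0] := eqVneq (frob_norm b) 0.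
    by rewrite (frob_norm_eq0 b0) mulmx0 /frob_norm frob_dot0r sqrtr0 mulr0.
  have bpos : 0 < frob_norm b by rewrite lt_def bn0 frob_norm_ge0.
  rewrite -ler_pdivrMr // mulrC -frob_normZ ?invr_ge0 ?frob_norm_ge0 //.
  rewrite scalemxAr ler_wsqrtr // vmax // inE /S /=.
  by rewrite !frob_dot_lin -frob_normE; field.
suff [u uS us] : exists2 u, S u & frob_dot u (X *m v) = s.
  exists u, v; rewrite us; split=> // [|a b]; first exact: frob_norm_ge0.
  apply: le_trans (ler_norm _) _; apply: le_trans (frob_dot_CS _ _) _.
  by rewrite mulrCA ler_wpM2l ?frob_norm_ge0.
(* If Xv = 0, any unit vector can serve as [u]. *)
have [s0|sn0] := eqVneq s 0.
  by exists (delta_mx 0 0) => //; rewrite s0 (frob_norm_eq0 s0) frob_dot0r.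
exists (s^-1 *: (X *m v)); rewrite /S /= !frob_dot_lin -frob_normE -/s; by field.
Qed.

(* H is the Householder reflection exchanging e_0 and u. *)
Lemma orthogonal_completion n (u : 'cV[R]_n.+1) : frob_dot u u = 1 ->
  exists2 H : 'M[R]_n.+1, H^T *m H = 1%:M & H *m delta_mx 0 0 = u.
Proof.
move=> u1; set e : 'cV[R]_n.+1 := delta_mx 0 0.
have [->|ue] := eqVneq u e.
  by exists 1%:M; rewrite ?trmx1 mul1mx.
pose w := e - u; pose k := 2 / frob_dot w w.
have w0 : frob_dot w w != 0.
  by apply: contra ue => /eqP/frob_dot_eq0/eqP; rewrite subr_eq0 eq_sym.
have scalar (a b : 'cV[R]_n.+1) : a^T *m b = (frob_dot a b)%:M.
  by rewrite [LHS]mx11_scalar; congr _%:M; rewrite frob_dotE /mxtrace big_ord1.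
have we : frob_dot w e * 2 = frob_dot w w.
  rewrite /w !frob_dot_lin u1 (frob_dotC e u) {1 3}/e !frob_dot_delta mxE !eqxx /=.
  by ring.
exists (1%:M - k *: (w *m w^T)); last first.
  rewrite mulmxBl mul1mx -scalemxAl -mulmxA scalar mul_mx_scalar scalerA.
  by rewrite /k mulrAC (mulrC 2) we divff // scale1r /w opprB addrC subrK.
set W := w *m w^T.
have WT : W^T = W by rewrite /W trmx_mul trmxK.
have WW : W *m W = frob_dot w w *: W.
  by rewrite /W -mulmxA (mulmxA w^T w) scalar mul_scalar_mx -scalemxAr.
have -> : (1%:M - k *: W)^T = 1%:M - k *: W.
  by apply/matrixP => i j; rewrite -[in RHS]WT !mxE eq_sym.
rewrite mulmxBl mul1mx mulmxBr mulmx1 -scalemxAl -scalemxAr WW !scalerA.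
have -> : k * k * frob_dot w w = k * 2 by rewrite /k; field.
by apply/matrixP => i j; rewrite !mxE; ring.
Qed.

(* Testing the bound with e_k and row k of Y shows that this row has norm at most s. *)
Lemma max_entry_row n (Y : 'M[R]_n) k s : Y k k = s ->
  (forall a b : 'cV[R]_n, frob_dot a (Y *m b) <= s * (frob_norm a * frob_norm b)) ->
  forall j, k != j -> Y k j = 0.
Proof.
move=> Ykk bound j kj; pose b := (row k Y)^T.
have bb : frob_dot b b = \sum_l Y k l ^+ 2.
  by apply: eq_bigr => l _; rewrite big_ord1 !mxE expr2.
have bs : s ^+ 2 + Y k j ^+ 2 <= frob_dot b b.
  rewrite bb (bigD1 k) //= Ykk (bigD1 j) 1?eq_sym //= addrA lerDl.
  by apply: sumr_ge0 => l _; exact: sqr_ge0.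
have := bound (delta_mx k 0) b.
have -> : frob_dot (delta_mx k 0) (Y *m b) = frob_dot b b.
  by rewrite frob_dot_delta mxE bb; apply: eq_bigr => l _; rewrite !mxE expr2.
have -> : frob_norm (delta_mx k 0 : 'cV[R]_n) = 1.
  by rewrite /frob_norm frob_dot_delta mxE !eqxx sqrtr1.
rewrite mul1r => bsb; apply/eqP; rewrite -sqrf_eq0 eq_le sqr_ge0 andbT.
rewrite -frob_normE in bs bsb.
have := sqr_ge0 (frob_norm b - s); nra.
Qed.

(** Induction on the size: rotating the top singular pair onto e_0 puts the operator norm in the
    corner, which forces the rest of the first row and column to vanish; the remaining block is
    handled by induction. *)
Lemma svd_exists n (X : 'M[R]_n) : exists U s V, is_svd X U s V.
Proof.
elim: n X => [|n IH] X.
  exists 0, 0, 0; rewrite /is_svd; split; first by rewrite [LHS]flatmx0 [RHS]flatmx0.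
  split; first by rewrite [LHS]flatmx0 [RHS]flatmx0.
  by split=> [[]//|]; rewrite [LHS]flatmx0 [RHS]flatmx0.
have [u [v [u1 v1 s0 smax]]] := top_singular_pair X.
set s := frob_dot u (X *m v) in s0 smax.
have [P PP Pe] := orthogonal_completion u1; have [Q QQ Qe] := orthogonal_completion v1.
have PP' := mulmx1C PP; have QQ' := mulmx1C QQ.
have [Y YE] : exists Y : 'M[R]_(1 + n), Y = P^T *m X *m Q by eexists.
have Ybound (a b : 'cV[R]_(1 + n)) : frob_dot a (Y *m b) <= s * (frob_norm a * frob_norm b).
  rewrite YE -!mulmxA -frob_dot_mull.
  by rewrite (le_trans (smax _ _)) // !frob_norm_isom.
have Y00 : Y 0 0 = s.
  by rewrite entryE YE -!mulmxA -frob_dot_mull Qe Pe.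
have Yur : ursubmx Y = 0.
  apply/matrixP => i j; rewrite ord1 !mxE lshift0.
  exact: (max_entry_row Y00 Ybound).
have Ydl : dlsubmx Y = 0.
  (* The column vanishes by the row argument applied to the transpose, which obeys the same
     bound. *)
  have YT0 j : 0 != j -> Y^T 0 j = 0.
    apply: (@max_entry_row _ Y^T 0 s) => [|a b]; first by rewrite mxE.
    by rewrite -frob_dot_mull frob_dotC (mulrC (frob_norm a)).
  apply/matrixP => i j; rewrite ord1 !mxE lshift0.
  by have := YT0 (rshift 1 i); rewrite mxE; apply.
have [U [t [V [UU [VV [t0 Yt]]]]]] := IH (drsubmx Y).
pose ext W : 'M[R]_(1 + n) := block_mx 1%:M 0 0 W.
have extO (W : 'M[R]_n) : W^T *m W = 1%:M -> (ext W)^T *m ext W = 1%:M.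
  move=> WW; rewrite /ext tr_block_mx mulmx_block !trmx0 trmx1 !mulmx0 !mul0mx.
  by rewrite mulmx1 WW !addr0 add0r -scalar_mx_block.
have Yeq : Y = ext U *m diag_mx (row_mx s%:M t) *m (ext V)^T.
  rewrite -[LHS]submxK Yur Ydl Yt /ext diag_mx_row tr_block_mx !mulmx_block.
  rewrite !trmx0 trmx1 !mulmx0 !mul0mx !mulmx1 !mul1mx !addr0 !add0r.
  congr block_mx; last by rewrite mul0mx.
  apply/matrixP => i j; rewrite !ord1 !mxE mulr1n.
  by rewrite -Y00; congr (Y _ _); apply/val_inj.
exists (P *m ext U); exists (row_mx s%:M t : 'rV[R]_(1 + n)); exists (Q *m ext V).
split.
  by rewrite trmx_mul -mulmxA (mulmxA P^T) PP mul1mx extO.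
split; first by rewrite trmx_mul -mulmxA (mulmxA Q^T) QQ mul1mx extO.
split.
  move=> i; rewrite mxE; case: splitP => j _ //.
  by rewrite ord1 mxE mulr1n.
rewrite trmx_mul -!mulmxA (mulmxA (ext U)) (mulmxA _ _ Q^T) -Yeq YE.
by rewrite !mulmxA PP' mul1mx -mulmxA QQ' mulmx1.
Qed.

End SVD.

(** * Clipping as projection onto the spectral ball, and the dual function it defines *)

Section SpectralProjection.
Context {R : realType} {n : nat}.
Variable c : R.
Hypothesis c0 : 0 < c.
Implicit Types X Y D E N H W : 'M[R]_n.

(** Once the orthogonal factors are stripped, what remains is diagonal with entries in [0, c]. *)
Lemma clip_spec_norm X Y : is_clip c X Y -> spec_norm Y <= c.
Proof.
move=> [U [s [V [[UU [VV [s0 _]]] ->]]]].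
apply/(spec_norm_leP _ (ltW c0)) => v; have VV' := mulmx1C VV.
set m := map_mx _ s; rewrite -!mulmxA frob_norm_isom //.
rewrite -[frob_norm v](@frob_norm_isom _ _ _ V^T); last by rewrite trmxK.
set w := V^T *m v.
rewrite -(ler_pXn2r (_ : (0 < 2)%N)) ?nnegrE ?mulr_ge0 ?frob_norm_ge0 ?(ltW c0) //.
rewrite exprMn !frob_normE /frob_dot mulr_sumr; apply: ler_sum => i _.
rewrite !big_ord1 mul_diag_mx !mxE -!expr2 exprMn ler_wpM2r ?sqr_ge0 //.
by rewrite ler_pXn2r ?nnegrE ?ge_min ?le_min ?s0 ?lexx ?orbT // ltW.
Qed.

Lemma clip_variational X Y D : is_clip c X Y -> spec_norm D <= c ->
  frob_dot (X - Y) (D - Y) <= 0.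
Proof.
move=> [U [s [V [[UU [VV [s0 ->]]] ->]]]] /(spec_norm_leP _ (ltW c0)) Dc.
set m := map_mx _ s.
rewrite -mulmxBl -mulmxBr -[diag_mx s - _]raddfB frob_dot_mulr frob_dot_mull trmxK.
rewrite frob_dot_diag; apply: sumr_le0 => i _.
have -> : (U^T *m ((D - U *m diag_mx m *m V^T) *m V)) = U^T *m D *m V - diag_mx m.
  by rewrite mulmxBl mulmxBr !mulmxA UU mul1mx -(mulmxA _ V^T) VV mulmx1.
(* The entry is U e_i . D (V e_i) with both vectors of norm 1. *)
have diag_le : (U^T *m D *m V) i i <= c.
  rewrite entryE -!mulmxA -frob_dot_mull mulmxA.
  apply: le_trans (ler_norm _) _; apply: le_trans (frob_dot_CS _ _) _.
  rewrite -mulmxA; apply: le_trans (ler_wpM2l (frob_norm_ge0 _) (Dc _)) _.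
  by rewrite !frob_norm_isom // /frob_norm frob_dot_delta mxE !eqxx sqrtr1 mul1r mulr1.
move: (U^T *m D *m V) diag_le => G Gc; rewrite !mxE eqxx mulr1n.
have [sc|cs] := leP (s 0 i) c; first by rewrite subrr mul0r.
by rewrite mulr_ge0_le0 // ?subr_ge0 ?subr_le0 // ltW.
Qed.

Lemma Pi_c_clip X : is_clip c X (Pi_c c X).
Proof.
apply: (@xgetPex _ 0 [set Y | is_clip c X Y]).
have [U [s [V svd]]] := svd_exists X.
by exists (U *m diag_mx (map_mx (fun x => Num.min x c) s) *m V^T); exists U, s, V.
Qed.

Lemma Pi_c_spec_norm X : spec_norm (Pi_c c X) <= c.
Proof. exact: clip_spec_norm (Pi_c_clip X). Qed.

Lemma Pi_c_variational X D : spec_norm D <= c ->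
  frob_dot (X - Pi_c c X) (D - Pi_c c X) <= 0.
Proof. exact: clip_variational (Pi_c_clip X). Qed.

(** With H = Y - X and P the difference of the projections, testing each variational inequality at
    the other projection gives P.P <= H.P; then |H - P|^2 >= 0 yields H.P <= H.H. *)
Lemma Pi_c_nonexpansive X Y :
  frob_dot (Y - X) (Pi_c c Y - Pi_c c X) <= frob_dot (Y - X) (Y - X).
Proof.
have := Pi_c_variational X (Pi_c_spec_norm Y).
have := Pi_c_variational Y (Pi_c_spec_norm X).
have -> : Y - Pi_c c Y = (X - Pi_c c X) + (Y - X) - (Pi_c c Y - Pi_c c X).
  by apply/matrixP => i j; rewrite !mxE; ring.
rewrite -[Pi_c c X - Pi_c c Y]opprB.
move: (X - Pi_c c X) (Y - X) (Pi_c c Y - Pi_c c X) => Q H P.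
have := frob_dot_ge0 (H - P).
rewrite !frob_dot_lin (frob_dotC P H); lra.
Qed.

Variable B : 'M[R]_n.

(** The Lagrangian at its minimizer; [B] stands for |A|, and [N] merges both multipliers. *)
Definition dual_fun N : R :=
  frob_dot (Pi_c c (B + N) - B) (Pi_c c (B + N) - B) / 2 - frob_dot N (Pi_c c (B + N)).

(** With D the projection, the two sides differ by |E - D|^2 / 2 - (B + N - D).(E - D), where the
    last product is nonpositive. *)
Lemma dual_fun_le N E : spec_norm E <= c ->
  dual_fun N <= frob_dot (E - B) (E - B) / 2 - frob_dot N E.
Proof.
move=> /(Pi_c_variational (B + N)); rewrite /dual_fun; set D := Pi_c c _.
have -> : B + N - D = N - (D - B) by apply/matrixP => i j; rewrite !mxE; ring.
have -> : E - B = (E - D) + (D - B) by rewrite addrA subrK.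
have -> : frob_dot N E = frob_dot N (E - D) + frob_dot N D.
  by rewrite -frob_dotDr subrK.
move: (E - D) (D - B) => F Q; have := frob_dot_ge0 F.
by rewrite !frob_dot_lin (frob_dotC F Q); lra.
Qed.

(** The minimizer for [N] is a competitor for [N + H], and the Lagrangian is affine in the
    multiplier. *)
Lemma dual_fun_supergradient N H :
  dual_fun (N + H) <= dual_fun N - frob_dot H (Pi_c c (B + N)).
Proof.
apply: le_trans (dual_fun_le (N + H) (Pi_c_spec_norm (B + N))) _.
by rewrite /dual_fun (frob_dotDl _ N); lra.
Qed.

(** The supergradient inequality at [N] bounds from above, the one at [N + H] from below;
    nonexpansiveness controls the gap. *)
Lemma dual_fun_expansion N H :
  `|dual_fun (N + H) - dual_fun N + frob_dot H (Pi_c c (B + N))| <= frob_dot H H.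
Proof.
have up := dual_fun_supergradient N H.
have := dual_fun_supergradient (N + H) (- H); rewrite addrK frob_dotNl => low.
have := Pi_c_nonexpansive (B + N) (B + (N + H)).
have -> : B + (N + H) - (B + N) = H by apply/matrixP => i j; rewrite !mxE; ring.
rewrite frob_dotDr frob_dotNr => ne.
by rewrite ler_norml; apply/andP; split; have := frob_dot_ge0 H; lra.
Qed.

End SpectralProjection.

(** * Differentiability from a quadratic remainder *)

Section Differentiability.
Context {R : realType}.

Lemma is_diff_quadratic (V : normedModType R) (f df : V -> R) x C :
  linear (df : V -> R^o) -> (forall h, `|df h| <= C * `|h|) ->
  (forall h, `|f (x + h) - f x - df h| <= C * `|h| ^+ 2) ->
  is_diff x (f : V -> R^o) (df : V -> R^o).
Proof.
move=> df_lin dfC fC.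
pose dfM := GRing.isLinear.Build _ _ _ _ _ df_lin.
pose dfL : {linear V -> R^o} := HB.pack (df : V -> R^o) dfM.
have dfc : continuous dfL.
  by apply: (@lipschitz_continuous _ _ _ _ C) => y z; rewrite -raddfB; exact: dfC.
(* [C] may be nonpositive; |C| + 1 can safely be divided by. *)
have C1 : 0 < `|C| + 1 by rewrite ltr_wpDl.
have fo : (f : V -> R^o) \o shift x = cst (f x) + dfL +o_ 0 id.
  apply/eqaddoP => _/posnumP[e].
  have e' : 0 < (`|C| + 1)^-1 * e%:num by rewrite mulr_gt0 ?invr_gt0.
  apply: filterS (@nbhs0_le _ V _ e') => h hle.
  rewrite /= !fctE /= opprD addrA (addrC h) (le_trans (fC h)) //.
  rewrite expr2 mulrA ler_wpM2r //.
  apply: le_trans (_ : (`|C| + 1) * `|h| <= _).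
    by rewrite ler_wpM2r // (le_trans (ler_norm _)) // lerDl.
  by rewrite -ler_pdivlMl.
have dfE := diff_unique dfc fo.
apply: DiffDef => //; apply/diff_locallyP; rewrite dfE; split=> //.
Qed.

End Differentiability.

(** * Smoothness, coercivity and first-order conditions of the dual function *)

Section DualFunction.
Context {R : realType} {n : nat}.
Variable c : R.
Hypothesis c0 : 0 < c.
Variable B : 'M[R]_n.
Implicit Types D E N H : 'M[R]_n.

Lemma frob_dot_le_norm (X Y : 'M[R]_n) :
  `|frob_dot X Y| <= (n * n)%:R * (`|X| * `|Y|).
Proof.
have -> : (n * n)%:R * (`|X| * `|Y|) = \sum_(i < n) \sum_(j < n) (`|X| * `|Y|).
  by rewrite !sumr_const card_ord -mulrnA mulr_natl.
apply: le_trans (ler_norm_sum _ _ _) _; apply: ler_sum => i _.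
apply: le_trans (ler_norm_sum _ _ _) _; apply: ler_sum => j _.
by rewrite normrM ler_pM // entry_le_norm.
Qed.

(** Stated for a linear [f] so as to serve both the identity, for continuity, and the map (L, M) to
    M - L o Z, for the gradients. *)
Lemma is_diff_dual_fun_comp (V : normedModType R) (f : V -> 'M[R]_n) K x :
  linear f -> 0 <= K -> (forall h, `|f h| <= K * `|h|) ->
  is_diff x (fun p => dual_fun c B (f p) : R^o)
    (fun h => - frob_dot (f h) (Pi_c c (B + f x)) : R^o).
Proof.
move=> f_lin K0 fK; set D := Pi_c c _.
have nn0 : 0 <= (n * n)%:R :> R by exact: ler0n.
(* The first summand bounds the linear form, the second the remainder; n * n is the cost of passing
   to the max norm. *)
apply: (@is_diff_quadratic _ _ _ _ _ ((n * n)%:R * K * `|D| + (n * n)%:R * K ^+ 2)).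
- by move=> a u v; rewrite f_lin frob_dotDl frob_dotZl opprD -mulrN.
- move=> h; rewrite normrN; apply: le_trans (frob_dot_le_norm _ _) _.
  rewrite mulrDl; apply: ler_wpDr; first by rewrite !mulr_ge0 ?exprn_ge0.
  by rewrite -!mulrA ler_wpM2l // [`|D| * _]mulrC mulrA ler_wpM2r.
move=> h; rewrite opprK.
have -> : f (x + h) = f x + f h.
  by have := f_lin 1 x h; rewrite !scale1r.
apply: le_trans (dual_fun_expansion c0 B (f x) (f h)) _.
apply: le_trans (ler_norm _) _; apply: le_trans (frob_dot_le_norm _ _) _.
rewrite mulrDl; apply: ler_wpDl; first by rewrite !mulr_ge0 ?exprn_ge0.
by rewrite -mulrA -exprMn -expr2 ler_wpM2l // ler_pXn2r ?nnegrE ?mulr_ge0.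
Qed.

Lemma dual_fun_continuous : continuous (dual_fun c B : 'M[R]_n -> R).
Proof.
move=> N; have idN (h : 'M[R]_n) : `|h| <= 1 * `|h| by rewrite mul1r.
have diffN := @ex_diff _ _ _ _ _ _ _ (@is_diff_dual_fun_comp _ id 1 N (fun _ _ _ => erefl) ler01 idN).
exact: differentiable_continuous diffN.
Qed.

(* The test point is the multiple of N of Frobenius norm c. *)
Lemma dual_fun_coercive N :
  dual_fun c B N <= c ^+ 2 + frob_dot B B - c * frob_norm N.
Proof.
have [N0|Nn0] := eqVneq (frob_norm N) 0.
  rewrite N0 mulr0 subr0 (frob_norm_eq0 N0).
  have spec0 : spec_norm (0 : 'M[R]_n) <= c.
    apply/(spec_norm_leP _ (ltW c0)) => v.
    by rewrite mul0mx {1}/frob_norm frob_dot0r sqrtr0 mulr_ge0 ?frob_norm_ge0 // ltW.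
  apply: le_trans (dual_fun_le c0 B 0 spec0) _.
  rewrite frob_dot0r sub0r !frob_dot_lin.
  by have := frob_dot_ge0 B; have := sqr_ge0 c; lra.
set E := (c / frob_norm N) *: N.
have NE : frob_dot N E = c * frob_norm N.
  by rewrite /E frob_dotZr -frob_normE; field.
have normE : frob_norm E = c.
  by rewrite /E frob_normZ ?divr_ge0 ?frob_norm_ge0 ?(ltW c0) // divfK.
have Ec : spec_norm E <= c.
  apply/(spec_norm_leP _ (ltW c0)) => v.
  by rewrite -normE frob_norm_mul.
apply: le_trans (dual_fun_le c0 B N Ec) _; rewrite NE lerD2r.
have := frob_dot_ge0 (E + B); rewrite -normE frob_normE.
clearbody E; rewrite !frob_dot_lin (frob_dotC B E); lra.
Qed.

Lemma dual_fun_first_order N H :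
  (forall t, 0 < t <= 1 -> dual_fun c B (N + t *: H) <= dual_fun c B N) ->
  0 <= frob_dot H (Pi_c c (B + N)).
Proof.
move=> maxN; set d := frob_dot H _; rewrite leNgt; apply/negP => d0.
have H0 := frob_dot_ge0 H; set q := frob_dot H H in H0 *.
(* This step lies in (0, 1] and satisfies t q < -d, so the linear gain -t d beats the remainder t^2
   q. *)
pose t := - d / (q - d + 1).
have den : 0 < q - d + 1 by lra.
have t0 : 0 < t by rewrite divr_gt0 // oppr_gt0.
have t1 : t <= 1 by rewrite ler_pdivrMr //; lra.
have tq : t * q < - d by rewrite mulrAC ltr_pdivrMr //; nra.
have /maxN : 0 < t <= 1 by rewrite t0.
have := dual_fun_expansion c0 B N (t *: H).
rewrite frob_dotZl !frob_dot_lin -/q -/d ler_norml => /andP[lo _] up.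
have : t * (t * q) < t * - d by rewrite ltr_pM2l.
lra.
Qed.

End DualFunction.

(** * Dual attainment and the optimality conditions *)

Section StrongDuality.
Context {R : realType} {n : nat}.
Variables (c : R) (B Z : 'M[R]_n).
Hypothesis c0 : 0 < c.
Hypothesis Z01 : forall i j, Z i j = 0 \/ Z i j = 1.

(* The pairs of multipliers (L, M) enter the dual function only through
   N = M - hadamard L Z, which ranges over this cone. *)
Definition dual_cone (N : 'M[R]_n) : Prop := forall i j, Z i j = 0 -> 0 <= N i j.

Lemma dual_max_exists : exists2 N0, dual_cone N0 &
  forall N, dual_cone N -> dual_fun c B N <= dual_fun c B N0.
Proof.
(* The radius at which the coercivity bound reaches 0. Outside the box the dual value is at most 0,
   hence at most its value at N = 0. *)
pose rho := (c ^+ 2 + frob_dot B B) / c.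
have rho0 : 0 <= rho.
  by rewrite divr_ge0 ?(ltW c0) // addr_ge0 ?sqr_ge0 ?frob_dot_ge0.
pose box := [set N : 'M[R]_n | dual_cone N /\ forall i j, `|N i j| <= rho].
have box0 : box 0 by split=> i j; rewrite mxE ?normr0.
have box_closed : closed box.
  have -> : box = \bigcap_(p in [set: 'I_n * 'I_n]) ((fun N : 'M[R]_n => N p.1 p.2) @^-1`
      ([set x | Z p.1 p.2 = 0 -> 0 <= x] `&` [set x | `|x| <= rho])).
    apply/seteqP; split=> [N [NZ Nrho] [i j] _|N Nbox]; first by split=> //=; exact: NZ.
    by split=> i j; have [] := Nbox (i, j) I.
  apply: closed_bigI => -[i j] _; apply: preimage_closed => [N _|].
    exact: coord_continuous.
  apply: closedI.
    have [Zij|Zij] := Z01 i j; rewrite /= Zij.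
      rewrite (_ : mkset _ = [set x | 0 <= x]); first exact: closed_ge.
      by apply/seteqP; split=> x /= => [|? _]; [apply|].
    rewrite (_ : mkset _ = setT); first exact: closedT.
    by apply/seteqP; split=> x //= _ /eqP; rewrite oner_eq0.
  apply: (@preimage_closed _ _ (fun x : R => `|x|) [set x | x <= rho]).
    by move=> x _; exact: norm_continuous.
  exact: closed_le.
have box_compact : compact box.
  by apply: (@mx_bounded_closed_compact _ _ _ _ rho) => // N [].
have [||N0 N0box N0max] := @compact_EVT_max _ _ (dual_fun c B) box _ box_compact.
- by exists 0.
- by apply/continuous_subspaceT; exact: dual_fun_continuous.
rewrite inE in N0box; exists N0 => [|N NZ]; first by case: N0box.
have [Nrho|] := pselect (forall i j, `|N i j| <= rho).
  by apply: N0max; rewrite inE.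
move=> /existsNP[i /existsNP[j /negP]]; rewrite -ltNge => Nij.
apply: le_trans (N0max 0 _); last by rewrite inE.
apply: le_trans (dual_fun_coercive c0 B N) _; apply: (@le_trans _ _ 0).
  rewrite subr_le0 -ler_pdivrMl // mulrC.
  by apply: le_trans (entry_le_frob N i j); exact: ltW.
rewrite /dual_fun (frob_dotC 0) frob_dot0r subr0.
by rewrite divr_ge0 // frob_dot_ge0.
Qed.

(** Each conclusion is a first-order condition along admissible directions: a unit matrix for the
    sign, its opposite where Z = 1 leaves the entry free, and both N0 and -N0 for
    complementarity. *)
Lemma dual_max_kkt N0 : dual_cone N0 ->
  (forall N, dual_cone N -> dual_fun c B N <= dual_fun c B N0) ->
  let D0 := Pi_c c (B + N0) in
  [/\ forall i j, 0 <= D0 i j, forall i j, Z i j * D0 i j = 0 & frob_dot N0 D0 = 0].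
Proof.
move=> N0Z N0max D0.
have opt H : (forall t, 0 < t <= 1 -> dual_cone (N0 + t *: H)) -> 0 <= frob_dot H D0.
  by move=> HZ; apply: dual_fun_first_order => // t /HZ/N0max.
have D0ge i j : 0 <= D0 i j.
  rewrite -frob_dot_delta; apply: opt => t /andP[t0 _] k l Zkl.
  by rewrite !mxE addr_ge0 ?N0Z // mulr_ge0 ?(ltW t0).
split=> // [i j|].
  have [Zij|Zij] := Z01 i j; rewrite Zij ?mul0r // mul1r.
  apply/eqP; rewrite eq_le D0ge andbT -oppr_ge0 -(frob_dot_delta i j) -frob_dotNl.
  apply: opt => t /andP[t0 _] k l Zkl; rewrite !mxE.
  case: (eqVneq k i) => [ki|_]; last by rewrite oppr0 mulr0 addr0 N0Z.
  case: (eqVneq l j) => [lj|_]; last by rewrite oppr0 mulr0 addr0 N0Z.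
  by move/eqP: Zkl; rewrite ki lj Zij oner_eq0.
apply/eqP; rewrite eq_le; apply/andP; split; last first.
  by apply: opt => t /andP[t0 _] k l Zkl; rewrite !mxE addr_ge0 ?mulr_ge0 ?N0Z ?(ltW t0).
(* Here t <= 1 matters: (1 - t) N0 must stay in the cone. *)
rewrite -oppr_ge0 -frob_dotNl; apply: opt => t /andP[_ t1] k l Zkl.
rewrite !mxE mulrN -[X in X - _]mul1r -mulrBl.
by rewrite mulr_ge0 ?subr_ge0 ?N0Z.
Qed.

(** Weak duality: where Z = 0 both factors are nonnegative, and where Z = 1 the entry of [D]
    vanishes. *)
Lemma dual_cone_dot (N D : 'M[R]_n) : dual_cone N -> (forall i j, 0 <= D i j) ->
  (forall i j, Z i j * D i j = 0) -> 0 <= frob_dot N D.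
Proof.
move=> NZ D0 ZD; apply: sumr_ge0 => i _; apply: sumr_ge0 => j _.
have [Zij|Zij] := Z01 i j; first by rewrite mulr_ge0 ?NZ.
by have := ZD i j; rewrite Zij mul1r => ->; rewrite mulr0.
Qed.

End StrongDuality.

(** * Entrywise comparison of norms and assembly of the theorem *)

Lemma frob_norm_le (R : realType) m n (X Y : 'M[R]_(m, n)) :
  (forall i j, `|X i j| <= `|Y i j|) -> frob_norm X <= frob_norm Y.
Proof.
move=> XY; apply: ler_wsqrtr; apply: ler_sum => i _; apply: ler_sum => j _.
rewrite -!expr2 -(real_normK (num_real (X i j))) -(real_normK (num_real (Y i j))).
by rewrite ler_pXn2r ?nnegrE.
Qed.

Unset Implicit Arguments.
Set Strict Implicit.
Set Printing Implicit Defensive.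

Theorem theorem7 (R : realType) (n : nat) (A : 'M[R]_n) (c : R) (Z : 'M[R]_n)
  (hn : (0 < n)%N) (hc : 0 < c) (hZ : forall i j, Z i j = 0 \/ Z i j = 1) :
  let Rm := mx_abs A in
  let Dm := fun L M : 'M[R]_n => Pi_c c (Rm + M - hadamard L Z) in
  let Lag := fun L M D : 'M[R]_n =>
    (frob_norm (D - Rm)) ^+ 2 / 2 + frob_dot3 L Z D - frob_dot M D in
  let g := fun L M : 'M[R]_n =>
    (frob_norm (Dm L M - Rm)) ^+ 2 / 2 + frob_dot3 L Z (Dm L M) - frob_dot M (Dm L M) in
  let feasP := fun B D : 'M[R]_n =>
    spec_norm D <= c /\ (forall i j, Z i j * D i j = 0) /\ D = mx_abs B in
  (* g is the Lagrangian dual function: the minimum over the spectral ball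
     of the Lagrangian, attained at D(L, M) *)
  (forall L M : 'M[R]_n, (forall i j, 0 <= M i j) ->
     spec_norm (Dm L M) <= c /\
     (forall D, spec_norm D <= c -> g L M <= Lag L M D)) /\
  (* equivalence of (P) and max_{M >= 0, L} g : both optima are attained
     and (1/2) (optimal value of (P))^2 = optimal value of the dual *)
  (exists B0 D0 L0 M0 : 'M[R]_n,
     feasP B0 D0 /\
     (forall B D, feasP B D -> frob_norm (A - B0) <= frob_norm (A - B)) /\
     (forall i j, 0 <= M0 i j) /\
     (forall L M : 'M[R]_n, (forall i j, 0 <= M i j) -> g L M <= g L0 M0) /\
     (frob_norm (A - B0)) ^+ 2 / 2 = g L0 M0) /\
  (* gradients: dg/dL = Z o D(L,M), dg/dM = - D(L,M) *)
  (forall L M : 'M[R]_n, (forall i j, 0 <= M i j) ->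
     is_diff (L, M) (fun p : 'M[R]_n * 'M[R]_n => g p.1 p.2)
       (fun h : 'M[R]_n * 'M[R]_n =>
          frob_dot (hadamard Z (Dm L M)) h.1 + frob_dot (- Dm L M) h.2)).
Proof.
move=> Rm Dm Lag g feasP.
pose phi (p : 'M[R]_n * 'M[R]_n) : 'M[R]_n := p.2 - hadamard p.1 Z.
have dot_had (L D : 'M[R]_n) : frob_dot (hadamard L Z) D = frob_dot3 L Z D.
  by apply: eq_bigr => i _; apply: eq_bigr => j _; rewrite mxE.
have DmE L M : Dm L M = Pi_c c (Rm + phi (L, M)) by rewrite /Dm addrA.
have LagE L M D :
    Lag L M D = frob_dot (D - Rm) (D - Rm) / 2 - frob_dot (phi (L, M)) D.
  by rewrite /Lag frob_normE /phi (frob_dotDl D M) frob_dotNl dot_had; ring.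
have gE L M : g L M = dual_fun c Rm (phi (L, M)).
  by rewrite -[LHS]/(Lag L M (Dm L M)) LagE DmE.
have phi_cone (L M : 'M[R]_n) : (forall i j, 0 <= M i j) -> dual_cone Z (phi (L, M)).
  by move=> M0 i j Zij; rewrite !mxE Zij mulr0 subr0.
split; [|split].
- move=> L M _; split; first exact: Pi_c_spec_norm.
  by move=> D Dc; rewrite gE LagE; exact: dual_fun_le.
- have [N0 N0Z N0max] := dual_max_exists Rm hc hZ.
  have [] := dual_max_kkt hc hZ N0Z N0max.
  set D0 := Pi_c c _ => D0ge ZD0 ND0.
  (* Giving [D0] the signs of [A] makes | |A| - |B0| | = |A - B0| entrywise. *)
  pose B0 := \matrix_(i, j) (if 0 <= A i j then D0 i j else - D0 i j).
  (* Splits [N0] along [Z]: free entries go to the equality multiplier, the others, nonnegative, to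
     [M0]. *)
  pose L0 := - hadamard N0 Z; pose M0 := N0 - hadamard N0 Z.
  have absB0 : mx_abs B0 = D0.
    apply/matrixP => i j; rewrite !mxE; case: ifP => _; last rewrite normrN.
      by rewrite ger0_norm.
    by rewrite ger0_norm.
  have distB0 : frob_norm (A - B0) = frob_norm (D0 - Rm).
    have entry i j : `|(A - B0) i j| = `|(D0 - Rm) i j|.
      rewrite !mxE; have [Aij|Aij] := leP 0 (A i j).
        by rewrite (ger0_norm Aij) distrC.
      by rewrite (ltr0_norm Aij) !opprK addrC.
    by apply/eqP; rewrite eq_le; apply/andP; split;
      apply: frob_norm_le => i j; rewrite entry.
  have phi0 : phi (L0, M0) = N0.
    apply/matrixP => i j; rewrite !mxE.
    by have [->|->] := hZ i j; ring.
  have dualN0 : dual_fun c Rm N0 = frob_norm (D0 - Rm) ^+ 2 / 2.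
    by rewrite /dual_fun -/D0 ND0 subr0 frob_normE.
  exists B0, D0, L0, M0; split; last split; last split; last split.
  + by split; [exact: Pi_c_spec_norm|].
  + move=> B D [Dc [ZD DB]]; rewrite distB0.
    apply: le_trans (_ : frob_norm (D - Rm) <= _); last first.
      apply: frob_norm_le => i j; rewrite DB !mxE distrC.
      exact: ler_dist_dist.
    rewrite -(ler_pXn2r (_ : (0 < 2)%N)) ?nnegrE ?frob_norm_ge0 //.
    have D_ge0 i j : 0 <= D i j by rewrite DB mxE.
    have := dual_cone_dot hZ N0Z D_ge0 ZD.
    have := dual_fun_le hc Rm N0 Dc.
    rewrite dualN0 !frob_normE; lra.
  + move=> i j; rewrite !mxE; have [Zij|Zij] := hZ i j; rewrite Zij.
      by rewrite mulr0 subr0 N0Z.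
    by rewrite mulr1 subrr.
  + by move=> L M M0ge; rewrite !gE phi0; exact/N0max/phi_cone.
  + by rewrite gE phi0 dualN0 distB0.
move=> L M _.
have phi_lin : linear phi.
  by move=> a x y; apply/matrixP => i j; rewrite !mxE; ring.
(* The norm of a pair is the maximum of the two, and multiplying by 0-1 entries does not increase
   the norm, hence the factor 2. *)
have phi_bound h : `|phi h| <= 2 * `|h|.
  rewrite mulr_natl mulr2n; apply: le_trans (ler_normB _ _) _; apply: lerD.
    by rewrite [leRHS]prod_normE le_max lexx orbT.
  apply: (@le_trans _ _ `|h.1|); last by rewrite [leRHS]prod_normE le_max lexx.
  apply: mx_norm_le => // i j; rewrite mxE.
  have [->|->] := hZ i j; first by rewrite mulr0 normr0.
  by rewrite mulr1 entry_le_norm.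
have := @is_diff_dual_fun_comp _ _ _ hc Rm _ phi 2 (L, M) phi_lin (ler0n _ _) phi_bound.
congr (is_diff_def _ _ _).
  by apply/funext => -[L' M']; rewrite gE.
apply/funext => h; rewrite -DmE /phi frob_dotDl frob_dotNl frob_dotNl dot_had.
rewrite opprD opprK addrC (frob_dotC h.2); congr (_ + _).
apply: eq_bigr => i _; apply: eq_bigr => j _; rewrite mxE; ring.
Qed.
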